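(* Let $R$ be an $(\alpha,\delta)$-compatible ring with an automorphism $\alpha$ and an $\alpha$-derivation $\delta$. Then $R$ is right $\mathfrak{cP}$-Baer if and only if the skew inverse power series ring $R[[x^{-1};\alpha,\delta]]$ is right $\mathfrak{cP}$-Baer.
   Context: All rings are associative with identity (not necessarily commutative). For a subset $S$ of a ring $R$, $r_R(S)=\{a\in R : sa=0 \text{ for all } s\in S\}$. A ring $R$ is right $\mathfrak{cP}$-Baer if for every idempotent $e=e^2\in R$ there is an idempotent $c=c^2\in R$ with $r_R(eR)=cR$. An $\alpha$-derivation of $R$ is an additive map $\delta:R\to R$ with $\delta(ab)=\delta(a)b+\alpha(a)\delta(b)$ for all $a,b\in R$. $R$ is $\alpha$-compatible if for all $a,b\in R$: $ab=0$ if and only if $a\alpha(b)=0$; $R$ is $\delta$-compatible if for all $a,b\in R$, $ab=0$ implies $a\delta(b)=0$; $R$ is $(\alpha,\delta)$-compatible if it is both. The skew inverse Laurent series ring $R((x^{-1};\alpha,\delta))$ consists of formal series $\sum_{i=m}^\infty a_ix^{-i}$ with $m\in\mathbb{Z}$ and $a_i\in R$, with usual addition and with multiplication determined by $xa=\alpha(a)x+\delta(a)$ and $x^{-1}a=\sum_{i=1}^\infty \alpha^{-1}(-\delta\alpha^{-1})^{i-1}(a)x^{-i}$ for $a\in R$. $R[[x^{-1};\alpha,\delta]]$ is its subring of series of the form $\sum_{i=0}^\infty a_ix^{-i}$. *)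

(* Defs.v *)
From HB Require Import structures.
From mathcomp Require Import all_boot all_order all_algebra.
From mathcomp Require Import boolp classical_sets cardinality fsbigop.
From mathcomp Require Import zify.

Set Implicit Arguments.
Unset Strict Implicit.
Unset Printing Implicit Defensive.

Import Order.TTheory GRing.Theory Num.Theory.
Local Open Scope classical_set_scope.
Local Open Scope ring_scope.

Definition right_annihilator (R : pzRingType) (S : set R) : set R :=
  [set a | forall s, S s -> s * a = 0].

Definition right_principal (R : pzRingType) (a : R) : set R :=
  [set a * r | r in [set: R]].

Definition right_cP_Baer (R : pzRingType) : Prop :=
  forall e : R, e * e = e ->
    exists2 c : R, c * c = c &
      right_annihilator (right_principal e) = right_principal c.

(* Additivity of an alpha-derivation is carried by the type {additive R -> R}. *)
Definition alpha_derivation (R : pzRingType) (alpha : {rmorphism R -> R})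
    (delta : {additive R -> R}) : Prop :=
  forall a b : R, delta (a * b) = delta a * b + alpha a * delta b.

Definition alpha_compatible (R : pzRingType) (alpha : R -> R) : Prop :=
  forall a b : R, a * b = 0 <-> a * alpha b = 0.

Definition delta_compatible (R : pzRingType) (delta : R -> R) : Prop :=
  forall a b : R, a * b = 0 -> a * delta b = 0.

Definition alpha_delta_compatible (R : pzRingType) (alpha delta : R -> R) :
    Prop :=
  alpha_compatible alpha /\ delta_compatible delta.

Lemma bijective_inverse (T U : Type) (f : T -> U) :
  bijective f -> exists g, cancel f g /\ cancel g f.
Proof. by case=> g fK gK; exists g. Qed.

Definition bij_inv (T U : Type) (f : T -> U) (f_bij : bijective f) : U -> T :=
  sval (cid (bijective_inverse f_bij)).

Lemma bij_invK (T U : Type) (f : T -> U) (f_bij : bijective f) :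
  cancel f (bij_inv f_bij).
Proof. by rewrite /bij_inv; case: cid => g []. Qed.

Lemma bij_invVK (T U : Type) (f : T -> U) (f_bij : bijective f) :
  cancel (bij_inv f_bij) f.
Proof. by rewrite /bij_inv; case: cid => g []. Qed.

Definition vanish_below (V : nmodType) (m : int) (f : int -> V) : Prop :=
  forall i, i < m -> f i = 0.

(* A series is encoded by its coefficients in powers of x^-1: f i is the
   coefficient of x^{-i}.  The bijectivity of alpha and the Leibniz rule are
   parameters of the type because its ring structure depends on them. *)
Record skew_laurent (R : pzRingType) (alpha : {rmorphism R -> R})
    (delta : {additive R -> R}) (alpha_bij : bijective alpha)
    (deltaM : alpha_derivation alpha delta) := SkewLaurent {
  lcoef :> int -> R;
  lcoef_bounded : exists m : int, vanish_below m lcoef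
}.

Section FiniteSums.
Variable V : nmodType.

Lemma fsum_nat_trunc (F : nat -> V) (N : nat) :
  (forall k, (N <= k)%N -> F k = 0) ->
  \sum_(k \in [set: nat]) F k = \sum_(k < N) F k.
Proof.
move=> F0; rewrite (@fsbigE _ _ _ _ _ (iota 0 N)) ?iota_uniq//.
  rewrite -(big_mkord xpredT) /index_iota subn0.
  by apply: eq_bigl => i; rewrite in_setT.
by move=> i _; rewrite mem_iota add0n /= -leqNgt => /F0.
Qed.

Lemma fsum_int_trunc (F : int -> V) (m : int) (N : nat) :
  (forall i, i < m -> F i = 0) -> (forall i, m + N%:Z <= i -> F i = 0) ->
  \sum_(i \in [set: int]) F i = \sum_(k < N) F (m + k%:Z).
Proof.
move=> Fl Fr; rewrite (@fsbigE _ _ _ _ _ [seq m + k%:Z | k <- iota 0 N]) //.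
- rewrite big_map -(big_mkord xpredT (fun k => F (m + k%:Z))).
  rewrite /index_iota subn0.
  by apply: eq_bigl => i; rewrite in_setT.
- by rewrite map_inj_uniq ?iota_uniq// => a b; lia.
- move=> i _ /mapP iN; have [/Fl//|mi] := ltP i m.
  have [/Fr//|iM] := leP (m + N%:Z) i.
  case: iN; exists (absz (i - m)%R); last by lia.
  by rewrite mem_iota; lia.
Qed.

End FiniteSums.

Section SkewLaurent.
Variables (R : pzRingType) (alpha : {rmorphism R -> R}).
Variables (delta : {additive R -> R}) (alpha_bij : bijective alpha).
Variable deltaM : alpha_derivation alpha delta.

Local Notation L := (skew_laurent alpha_bij deltaM).
Local Notation alphaV := (bij_inv alpha_bij).

Lemma skew_laurentP (f g : L) : (forall i, f i = g i) -> f = g.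
Proof.
case: f g => [f fP] [g gP] /= /funext fg; case: _ / fg in gP *.
by congr SkewLaurent; exact: Prop_irrelevance.
Qed.

HB.instance Definition _ := gen_eqMixin L.
HB.instance Definition _ := gen_choiceMixin L.

Definition laurent_zero : L.
Proof. by exists (fun=> 0); exists 0. Defined.

Definition laurent_opp (f : L) : L.
Proof.
exists (fun i => - f i); case: (lcoef_bounded f) => m fm; exists m => i im.
by rewrite fm ?oppr0.
Defined.

Definition laurent_add (f g : L) : L.
Proof.
exists (fun i => f i + g i).
case: (lcoef_bounded f) (lcoef_bounded g) => m fm [p gp].
by exists (Num.min m p) => i; rewrite lt_min => /andP[? ?]; rewrite fm ?gp ?addr0.
Defined.

Lemma laurent_addA : associative laurent_add.
Proof. by move=> f g h; apply/skew_laurentP => i /=; rewrite addrA. Qed.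

Lemma laurent_addC : commutative laurent_add.
Proof. by move=> f g; apply/skew_laurentP => i /=; rewrite addrC. Qed.

Lemma laurent_add0 : left_id laurent_zero laurent_add.
Proof. by move=> f; apply/skew_laurentP => i /=; rewrite add0r. Qed.

Lemma laurent_addN : left_inverse laurent_zero laurent_opp laurent_add.
Proof. by move=> f; apply/skew_laurentP => i /=; rewrite addNr. Qed.

HB.instance Definition _ := GRing.isZmodule.Build L
  laurent_addA laurent_addC laurent_add0 laurent_addN.

Lemma lcoef0 i : (0 : L) i = 0. Proof. by []. Qed.
Lemma lcoefD (f g : L) i : (f + g) i = f i + g i. Proof. by []. Qed.
Lemma lcoefN (f : L) i : (- f) i = - f i. Proof. by []. Qed.

(* x * (sum_i f_i x^{-i}) = sum_i (alpha(f_i) x^{-(i-1)} + delta(f_i) x^{-i}) *)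
Definition xmul_coef (f : int -> R) (n : int) : R :=
  alpha (f (n + 1)) + delta (f n).

(* xinv_term k a is the coefficient of x^{-(k+1)} in x^{-1} * a *)
Definition xinv_term (k : nat) (a : R) : R :=
  alphaV (iter k (fun b => - delta (alphaV b)) a).

(* The coefficient of x^{-n} in
   x^{-1} * (sum_i f_i x^{-i}) = sum_i sum_(k >= 0) xinv_term k f_i x^{-(i+k+1)};
   the summands vanish for all but finitely many k. *)
Definition xinv_coef (f : int -> R) (n : int) : R :=
  \sum_(k \in [set: nat]) xinv_term k (f (n - k.+1%:Z)).

(* The coefficients of x^{-i} * f *)
Definition xpow_coef (i : int) (f : int -> R) : int -> R :=
  match i with
  | Posz k => iter k xinv_coef f
  | Negz k => iter k.+1 xmul_coef f
  end.

(* (sum_i f_i x^{-i}) * g = sum_i f_i (x^{-i} * g); in each degree all but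
   finitely many summands vanish. *)
Definition laurent_mul_coef (f g : int -> R) (n : int) : R :=
  \sum_(i \in [set: int]) f i * xpow_coef i g n.

Definition monomial_coef (a : R) (i : int) (n : int) : R :=
  if n == i then a else 0.

Lemma alphaV0 : alphaV 0 = 0.
Proof. by rewrite -[in LHS](raddf0 alpha) bij_invK. Qed.

Lemma alphaVD : {morph alphaV : a b / a + b}.
Proof.
by move=> a b; apply: (bij_inj alpha_bij); rewrite rmorphD !bij_invVK.
Qed.

Lemma xinv_term0 k : xinv_term k 0 = 0.
Proof.
rewrite /xinv_term; suff -> : iter k (fun b => - delta (alphaV b)) 0 = 0.
  by rewrite alphaV0.
by elim: k => //= k ->; rewrite alphaV0 raddf0 oppr0.
Qed.

Lemma xinv_termD k : {morph xinv_term k : a b / a + b}.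
Proof.
move=> a b; rewrite /xinv_term -alphaVD; congr alphaV.
by elim: k => //= k ->; rewrite alphaVD raddfD opprD.
Qed.

Lemma alpha_xinv_term k a :
  alpha (xinv_term k a) = iter k (fun b => - delta (alphaV b)) a.
Proof. by rewrite /xinv_term bij_invVK. Qed.

Lemma delta_xinv_term k a :
  delta (xinv_term k a) = - alpha (xinv_term k.+1 a).
Proof. by rewrite alpha_xinv_term /= opprK. Qed.

Lemma xinv_term_alpha a : xinv_term 0 (alpha a) = a.
Proof. by rewrite /xinv_term /= bij_invK. Qed.

Lemma xinv_termS_alpha k a : xinv_term k.+1 (alpha a) = xinv_term k (- delta a).
Proof. by rewrite /xinv_term iterSr bij_invK. Qed.

Lemma derivation1 : delta 1 = 0.
Proof.
have /eqP := deltaM 1 1.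
by rewrite !mulr1 rmorph1 mul1r -{1}[delta 1]addr0 (inj_eq (addrI _)) => /eqP.
Qed.

Lemma xinv_coefE (f : int -> R) (m n : int) (N : nat) :
  vanish_below m f -> n <= m + N%:Z ->
  xinv_coef f n = \sum_(k < N) xinv_term k (f (n - k.+1%:Z)).
Proof.
move=> fm nN; rewrite /xinv_coef (fsum_nat_trunc (N := N))// => k kN.
by rewrite fm ?xinv_term0//; lia.
Qed.

Lemma vanish_xmul (m : int) (f : int -> R) :
  vanish_below m f -> vanish_below (m - 1) (xmul_coef f).
Proof.
by move=> fm i im; rewrite /xmul_coef !fm ?raddf0 ?addr0//; lia.
Qed.

Lemma vanish_xinv (m : int) (f : int -> R) :
  vanish_below m f -> vanish_below (m + 1) (xinv_coef f).
Proof. by move=> fm i im; rewrite (xinv_coefE (N := 0) fm) ?big_ord0//; lia. Qed.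

Lemma xmul_coefK (m : int) (f : int -> R) :
  vanish_below m f -> xinv_coef (xmul_coef f) = f.
Proof.
move=> fm; apply/funext => n; have fm' := vanish_xmul fm.
set N := absz (n - (m - 1))%R.
rewrite (xinv_coefE (N := N.+1) fm'); last by lia.
rewrite /xmul_coef.
under eq_bigr => k _ do rewrite xinv_termD.
rewrite big_split big_ord_recl big_ord_recr /= xinv_term_alpha.
have -> : n - 1%N%:Z + 1 = n by lia.
rewrite -addrA; rewrite (fm (n - N.+1%:Z)); last by lia.
rewrite raddf0 xinv_term0 addr0 -big_split big1 /= ?addr0// => k _.
rewrite /bump /= add1n xinv_termS_alpha -xinv_termD.
have -> : n - k.+2%:Z + 1 = n - k.+1%:Z by lia.
by rewrite addNr xinv_term0.
Qed.

Lemma xinv_coefK (m : int) (f : int -> R) :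
  vanish_below m f -> xmul_coef (xinv_coef f) = f.
Proof.
move=> fm; apply/funext => n; rewrite /xmul_coef.
set N := absz (n - m)%R.
rewrite (xinv_coefE (N := N.+1) fm); last by lia.
rewrite (xinv_coefE (N := N) fm); last by lia.
rewrite !raddf_sum big_ord_recl /= alpha_xinv_term /=.
have -> : n + 1 - 1%N%:Z = n by lia.
rewrite -addrA -big_split big1 /= ?addr0// => k _.
rewrite delta_xinv_term /bump /= add1n.
have -> : n + 1 - k.+2%:Z = n - k.+1%:Z by lia.
by rewrite addrN.
Qed.

Lemma vanish_xpow (m i : int) (f : int -> R) :
  vanish_below m f -> vanish_below (m + i) (xpow_coef i f).
Proof.
move=> fm; case: i => k /=.
  elim: k => [|k /vanish_xinv IH]; first by rewrite addr0.
  by have -> : m + k.+1%:Z = m + k%:Z + 1 by lia.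
elim: k => [|k /vanish_xmul IH] /=.
  by rewrite (_ : m + Negz 0 = m - 1) ?NegzE//; exact: vanish_xmul.
by have -> : m + Negz k.+1 = m + Negz k - 1 by lia.
Qed.

Lemma xpow_coefS (m i : int) (f : int -> R) :
  vanish_below m f -> xpow_coef (i + 1) f = xinv_coef (xpow_coef i f).
Proof.
move=> fm; case: i => k.
  by have -> : k%:Z + 1 = k.+1%:Z by lia.
have -> : Negz k + 1 = - k%:Z by lia.
have -> : xpow_coef (Negz k) f = xmul_coef (xpow_coef (- k%:Z) f).
  by case: k.
by rewrite (xmul_coefK (vanish_xpow (i := - k%:Z) fm)).
Qed.

Lemma xpow_coefB (m i : int) (f : int -> R) :
  vanish_below m f -> xmul_coef (xpow_coef i f) = xpow_coef (i - 1) f.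
Proof.
move=> fm; rewrite -{1}(subrK 1 i) (xpow_coefS _ fm).
exact: xinv_coefK (vanish_xpow fm).
Qed.

Lemma xmul_coefD (f g : int -> R) :
  xmul_coef (fun i => f i + g i) = fun i => xmul_coef f i + xmul_coef g i.
Proof. by apply/funext => i; rewrite /xmul_coef !raddfD addrACA. Qed.

Lemma xinv_coefD (m p : int) (f g : int -> R) :
  vanish_below m f -> vanish_below p g ->
  xinv_coef (fun i => f i + g i) = fun i => xinv_coef f i + xinv_coef g i.
Proof.
move=> fm gp.
have Vf := vanish_xinv fm; have Vg := vanish_xinv gp.
rewrite -{1}(xinv_coefK fm) -{1}(xinv_coefK gp) -xmul_coefD.
apply: (xmul_coefK (m := Num.min (m + 1) (p + 1))) => i.
by rewrite lt_min => /andP[? ?]; rewrite Vf ?Vg ?addr0.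
Qed.

Lemma xpow_coefD (m p i : int) (f g : int -> R) :
  vanish_below m f -> vanish_below p g ->
  xpow_coef i (fun n => f n + g n) = fun n => xpow_coef i f n + xpow_coef i g n.
Proof.
move=> fm gp; case: i => k.
  elim: k => //= k ->.
  exact: (xinv_coefD (vanish_xpow (i := k%:Z) fm) (vanish_xpow (i := k%:Z) gp)).
elim: k => [|k /= IH] /=; first exact: xmul_coefD.
by rewrite IH xmul_coefD.
Qed.

Lemma laurent_mul_coefE (f g : int -> R) (m p n : int) (N : nat) :
  vanish_below m f -> vanish_below p g -> n < m + N%:Z + p ->
  laurent_mul_coef f g n = \sum_(k < N) f (m + k%:Z) * xpow_coef (m + k%:Z) g n.
Proof.
move=> fm gp nN; rewrite /laurent_mul_coef (fsum_int_trunc (m := m) (N := N))//.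
  by move=> i im; rewrite fm ?mul0r.
by move=> i im; rewrite (vanish_xpow gp) ?mulr0//; lia.
Qed.

Lemma vanish_laurent_mul (f g : int -> R) (m p : int) :
  vanish_below m f -> vanish_below p g ->
  vanish_below (m + p) (laurent_mul_coef f g).
Proof.
move=> fm gp i im; rewrite (laurent_mul_coefE (N := 0) fm gp) ?big_ord0//.
by lia.
Qed.

Definition laurent_mul (f g : L) : L.
Proof.
exists (laurent_mul_coef f g).
case: (lcoef_bounded f) (lcoef_bounded g) => m fm [p gp].
by exists (m + p); exact: vanish_laurent_mul.
Defined.

Definition laurent_monomial (a : R) (i : int) : L.
Proof.
exists (monomial_coef a i); exists i => n ni.
by rewrite /monomial_coef lt_eqF.
Defined.

Lemma xmul_laurent_mul (f g : int -> R) (m p : int) :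
  vanish_below m f -> vanish_below p g ->
  xmul_coef (laurent_mul_coef f g) = laurent_mul_coef (xmul_coef f) g.
Proof.
move=> fm gp; apply/funext => n; rewrite {1}/xmul_coef.
have fm' := vanish_xmul fm; set N := absz (n + 1 - (m + p))%R.
rewrite (laurent_mul_coefE (N := N.+2) fm' gp); last by lia.
rewrite (laurent_mul_coefE (n := n + 1) (N := N.+1) fm gp); last by lia.
rewrite (laurent_mul_coefE (N := N.+1) fm gp); last by lia.
rewrite !raddf_sum -big_split /=.
rewrite /xmul_coef; under [RHS]eq_bigr => k _ do rewrite mulrDl.
rewrite [RHS]big_split /= [X in _ = X + _]big_ord_recr /=.
rewrite [X in _ = _ + X]big_ord_recl /=.
have /(_ n) -> := vanish_xpow (i := m - 1 + N.+1%:Z) gp; last by lia.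
rewrite mulr0 addr0 (fm (m - 1 + 0%N%:Z)); last by lia.
rewrite raddf0 mul0r add0r -big_split /=.
apply: eq_bigr => k _; rewrite /bump /= add1n.
have -> : m - 1 + k%:Z + 1 = m + k%:Z by lia.
have -> : m - 1 + k.+1%:Z = m + k%:Z by lia.
have -> : m - 1 + k%:Z = m + k%:Z - 1 by lia.
rewrite -(xpow_coefB _ gp) /xmul_coef rmorphM deltaM mulrDr -!addrA.
by congr (_ + _); rewrite addrC.
Qed.

Lemma xinv_laurent_mul (f g : int -> R) (m p : int) :
  vanish_below m f -> vanish_below p g ->
  xinv_coef (laurent_mul_coef f g) = laurent_mul_coef (xinv_coef f) g.
Proof.
move=> fm gp; have fm' := vanish_xinv fm.
rewrite -[in LHS](xinv_coefK fm) -(xmul_laurent_mul fm' gp).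
exact: xmul_coefK (vanish_laurent_mul fm' gp).
Qed.

Lemma xpow_laurent_mul (f g : int -> R) (m p i : int) :
  vanish_below m f -> vanish_below p g ->
  xpow_coef i (laurent_mul_coef f g) = laurent_mul_coef (xpow_coef i f) g.
Proof.
move=> fm gp; case: i => k /=.
  elim: k => //= k ->.
  exact: xinv_laurent_mul (vanish_xpow (i := k%:Z) fm) gp.
elim: k => /= [|k ->]; first exact: xmul_laurent_mul fm gp.
exact: xmul_laurent_mul (vanish_xpow (i := Negz k) fm) gp.
Qed.

Lemma xpow_monomial1 (i j : int) :
  xpow_coef i (monomial_coef 1 j) = monomial_coef 1 (j + i).
Proof.
have low (k : int) : vanish_below k (monomial_coef 1 k).
  by move=> n nk; rewrite /monomial_coef lt_eqF.
have step k : xmul_coef (monomial_coef 1 (k + 1)) = monomial_coef 1 k.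
  apply/funext => n; rewrite /xmul_coef /monomial_coef (inj_eq (addIr _)).
  by case: eqP; case: eqP; rewrite ?rmorph1 ?raddf0 ?derivation1 ?addr0.
have stepV k : xinv_coef (monomial_coef 1 k) = monomial_coef 1 (k + 1).
  by rewrite -{1}step (xmul_coefK (low _)).
case: i => k /=.
  elim: k => [|k /= ->]; first by rewrite addr0.
  by rewrite stepV; congr monomial_coef; lia.
elim: k => [|k /= ->] /=; rewrite -[RHS]step; congr (xmul_coef _);
  by congr monomial_coef; lia.
Qed.

Lemma laurent_mulA : associative laurent_mul.
Proof.
move=> f g h; apply/skew_laurentP => n /=.
case: (lcoef_bounded f) => m fm; case: (lcoef_bounded g) => p gp.
case: (lcoef_bounded h) => q hq; set N := (absz (n - (m + p + q))%R).+1.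
have gh := vanish_laurent_mul gp hq; have fg := vanish_laurent_mul fm gp.
rewrite (laurent_mul_coefE (N := N) fm gh); last by lia.
rewrite (laurent_mul_coefE (N := N) fg hq); last by lia.
have -> : \sum_(k < N) f (m + k%:Z) *
    xpow_coef (m + k%:Z) (laurent_mul_coef g h) n =
  \sum_(k < N) \sum_(j < N) f (m + k%:Z) *
    (xpow_coef (m + k%:Z) g (m + p + j%:Z) * xpow_coef (m + p + j%:Z) h n).
  apply: eq_bigr => k _; rewrite -mulr_sumr (xpow_laurent_mul _ gp hq).
  congr (_ * _); apply: (laurent_mul_coefE (p := q) _ hq); last by lia.
  by move=> i im; rewrite (vanish_xpow gp)//; lia.
rewrite exchange_big /=; apply: eq_bigr => j _.
rewrite (laurent_mul_coefE (N := N) fm gp); last first.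
  by have := ltn_ord j; lia.
by rewrite mulr_suml; apply: eq_bigr => k _; rewrite mulrA.
Qed.

Lemma laurent_mul1l : left_id (laurent_monomial 1 0) laurent_mul.
Proof.
move=> f; apply/skew_laurentP => n /=.
rewrite /laurent_mul_coef (fsum_int_trunc (m := 0) (N := 1)).
- by rewrite big_ord1 /monomial_coef /= mul1r.
- by move=> i i0; rewrite /monomial_coef lt_eqF ?mul0r.
- by move=> i i1; rewrite /monomial_coef gt_eqF ?mul0r//; lia.
Qed.

Lemma laurent_mul1r : right_id (laurent_monomial 1 0) laurent_mul.
Proof.
move=> f; apply/skew_laurentP => n /=.
rewrite /laurent_mul_coef (fsum_int_trunc (m := n) (N := 1)).
- by rewrite big_ord1 addr0 xpow_monomial1 add0r /monomial_coef eqxx mulr1.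
- by move=> i i0; rewrite xpow_monomial1 add0r /monomial_coef gt_eqF ?mulr0.
- by move=> i i1; rewrite xpow_monomial1 add0r /monomial_coef lt_eqF ?mulr0//; lia.
Qed.

Lemma laurent_mulDl : left_distributive laurent_mul +%R.
Proof.
move=> f g h; apply/skew_laurentP => n; rewrite lcoefD /=.
case: (lcoef_bounded f) => m0 fm0; case: (lcoef_bounded g) => m1 fm1.
case: (lcoef_bounded h) => q hq; pose m := Num.min m0 m1.
have fm : vanish_below m f.
  by move=> i; rewrite lt_min => /andP[/fm0].
have gm : vanish_below m g.
  by move=> i; rewrite lt_min => /andP[_ /fm1].
have fgm : vanish_below m (lcoef (f + g)).
  by move=> i im; rewrite lcoefD fm ?gm ?addr0.
set N := (absz (n - (m + q))%R).+1.
rewrite (laurent_mul_coefE (N := N) fgm hq); last by lia.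
rewrite (laurent_mul_coefE (N := N) fm hq); last by lia.
rewrite (laurent_mul_coefE (N := N) gm hq); last by lia.
by rewrite -big_split; apply: eq_bigr => k _ /=; rewrite -mulrDl.
Qed.

Lemma laurent_mulDr : right_distributive laurent_mul +%R.
Proof.
move=> h f g; apply/skew_laurentP => n; rewrite lcoefD /=.
case: (lcoef_bounded f) => m0 fm0; case: (lcoef_bounded g) => m1 fm1.
case: (lcoef_bounded h) => q hq; pose m := Num.min m0 m1.
have fm : vanish_below m f.
  by move=> i; rewrite lt_min => /andP[/fm0].
have gm : vanish_below m g.
  by move=> i; rewrite lt_min => /andP[_ /fm1].
have fgm : vanish_below m (lcoef (f + g)).
  by move=> i im; rewrite lcoefD fm ?gm ?addr0.
set N := (absz (n - (q + m))%R).+1.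
rewrite (laurent_mul_coefE (N := N) hq fgm); last by lia.
rewrite (laurent_mul_coefE (N := N) hq fm); last by lia.
rewrite (laurent_mul_coefE (N := N) hq gm); last by lia.
rewrite -big_split; apply: eq_bigr => k _ /=.
by rewrite -mulrDr (xpow_coefD _ fm gm).
Qed.

HB.instance Definition _ := GRing.Zmodule_isPzRing.Build L
  laurent_mulA laurent_mul1l laurent_mul1r laurent_mulDl laurent_mulDr.

Lemma lcoefM (f g : L) n :
  (f * g) n = \sum_(i \in [set: int]) f i * xpow_coef i g n.
Proof. by []. Qed.

Lemma lcoef1 n : (1 : L) n = if n == 0 then 1 else 0.
Proof. by []. Qed.

Lemma lcoef_monomial a i n :
  laurent_monomial a i n = if n == i then a else 0.
Proof. by []. Qed.

Lemma laurent_monomial1_mul i (f : L) n :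
  (laurent_monomial 1 i * f) n = xpow_coef i f n.
Proof.
rewrite lcoefM (fsum_int_trunc (m := i) (N := 1)).
- by rewrite big_ord1 addr0 lcoef_monomial eqxx mul1r.
- by move=> j ji; rewrite lcoef_monomial lt_eqF ?mul0r.
- by move=> j ji; rewrite lcoef_monomial gt_eqF ?mul0r//; lia.
Qed.

Lemma laurent_monomialM a i j :
  laurent_monomial a i * laurent_monomial 1 j = laurent_monomial a (i + j).
Proof.
apply/skew_laurentP => n; rewrite lcoefM (fsum_int_trunc (m := i) (N := 1)).
- rewrite big_ord1 addr0 !lcoef_monomial eqxx xpow_monomial1 addrC.
  by rewrite /monomial_coef addrC; case: eqP; rewrite ?mulr1 ?mulr0.
- by move=> k ki; rewrite lcoef_monomial lt_eqF ?mul0r.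
- by move=> k ki; rewrite lcoef_monomial gt_eqF ?mul0r//; lia.
Qed.

(* x a = alpha(a) x + delta(a) *)
Lemma laurent_x_comm (a : R) :
  laurent_monomial 1 (-1) * laurent_monomial a 0 =
  laurent_monomial (alpha a) (-1) + laurent_monomial (delta a) 0.
Proof.
apply/skew_laurentP => n; rewrite laurent_monomial1_mul lcoefD.
rewrite !lcoef_monomial /= /xmul_coef /monomial_coef.
rewrite -[n == -1]subr_eq0 opprK.
by do 2![case: eqP => _]; rewrite ?raddf0 ?addr0.
Qed.

(* x^{-1} a = sum_(i >= 1) alpha^{-1} (- delta alpha^{-1})^{i-1}(a) x^{-i} *)
Lemma laurent_xinv_comm (a : R) (n : int) :
  (laurent_monomial 1 1 * laurent_monomial a 0) n =
  if n is Posz i.+1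
  then alphaV (iter i (fun b => - delta (alphaV b)) a) else 0.
Proof.
rewrite laurent_monomial1_mul /=.
have low : vanish_below 0 (monomial_coef a 0).
  by move=> i i0; rewrite /monomial_coef lt_eqF.
case: n => [[|n]|n].
- by rewrite (vanish_xinv low).
- rewrite (xinv_coefE (N := n.+1) low) //.
  rewrite big_ord_recr /= subrr {2}/monomial_coef eqxx big1 ?add0r// => k _.
  rewrite /monomial_coef gt_eqF ?xinv_term0//.
  by have := ltn_ord k; lia.
- by rewrite (vanish_xinv low).
Qed.

Definition is_power_series : {pred L} :=
  fun f => `[< vanish_below 0 (lcoef f) >].

Lemma is_power_seriesP (f : L) :
  reflect (forall i, i < 0 -> f i = 0) (f \in is_power_series).
Proof. exact: asboolP. Qed.

Lemma is_power_series_subring : subring_closed is_power_series.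
Proof.
split=> [|f g /is_power_seriesP fP /is_power_seriesP gP
         |f g /is_power_seriesP fP /is_power_seriesP gP];
  apply/is_power_seriesP => i i0.
- by rewrite lcoef1 lt_eqF.
- by rewrite lcoefD lcoefN fP ?gP ?subr0.
- by apply: (vanish_laurent_mul fP gP); lia.
Qed.

HB.instance Definition _ :=
  GRing.isSubringClosed.Build L is_power_series is_power_series_subring.

End SkewLaurent.

(* R[[x^{-1}; alpha, delta]] as a subring of R((x^{-1}; alpha, delta)) *)
Record skew_power_series (R : pzRingType) (alpha : {rmorphism R -> R})
    (delta : {additive R -> R}) (alpha_bij : bijective alpha)
    (deltaM : alpha_derivation alpha delta) := SkewPowerSeries {
  laurent_of :> skew_laurent alpha_bij deltaM;
  laurent_ofP : laurent_of \in @is_power_series R alpha delta alpha_bij deltaM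
}.

Section SkewPowerSeries.
Variables (R : pzRingType) (alpha : {rmorphism R -> R}).
Variables (delta : {additive R -> R}) (alpha_bij : bijective alpha).
Variable deltaM : alpha_derivation alpha delta.

Local Notation S := (skew_power_series alpha_bij deltaM).

HB.instance Definition _ :=
  [isSub of S for @laurent_of R alpha delta alpha_bij deltaM].
HB.instance Definition _ := [Choice of S by <:].
HB.instance Definition _ := GRing.SubChoice_isSubPzRing.Build
  (skew_laurent alpha_bij deltaM) _ S
  (@is_power_series_subring R alpha delta alpha_bij deltaM).

Lemma laurent_of_rmorphism :
  zmod_morphism (@laurent_of R alpha delta alpha_bij deltaM) /\
  monoid_morphism (@laurent_of R alpha delta alpha_bij deltaM).
Proof. by []. Qed.

End SkewPowerSeries.

(* Main.v *)
(** Write S for the power series ring. Compatibility makes the annihilator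
    r_R(X) of any subset X of R stable under alpha^-1 and delta. Hence, for e in
    R, a series lies in r_S(eS) exactly when all its coefficients lie in
    r_R(eR); in particular r_R(eR) = cR implies r_S(eS) = cS. The constant term
    is a ring morphism S -> R, and a series with constant term 1 is left
    regular. If E, F are idempotents of S with the same constant term, then
    u = FE + (1 - F)(1 - E) is such a series and u E = FE, so FSf = 0 gives
    u (ESf) = F (ESf) = 0 and ESf = 0. Thus r_S(ES) = r_S(FS), and E may be
    replaced by its constant term. *)

Require Import Defs.
From mathcomp Require Import all_boot all_order all_algebra.
From mathcomp Require Import boolp classical_sets.
From mathcomp Require Import zify.

Set Implicit Arguments.
Unset Strict Implicit.
Unset Printing Implicit Defensive.

Import Order.TTheory GRing.Theory Num.Theory.
Local Open Scope ring_scope.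

Lemma right_principalP (R : pzRingType) (c a : R) :
  c * c = c -> right_principal c a <-> c * a = a.
Proof.
move=> cc; split=> [[r _ <-]|ca]; first by rewrite mulrA cc.
by exists a.
Qed.

Lemma right_annihilator_principalP (R : pzRingType) (e a : R) :
  right_annihilator (right_principal e) a <-> forall r, e * r * a = 0.
Proof.
split=> [ea r|ea _ [r _ <-]]; last exact: ea.
by apply: ea; exists r.
Qed.

Section CompatiblePowerSeries.
Variables (R : pzRingType) (alpha : {rmorphism R -> R}).
Variables (delta : {additive R -> R}) (alpha_bij : bijective alpha).
Variable deltaM : alpha_derivation alpha delta.
Hypothesis compat : alpha_delta_compatible alpha delta.

Local Notation alphaV := (bij_inv alpha_bij).
Local Notation S := (skew_power_series alpha_bij deltaM).

Lemma right_annihilator_xinv_term (X : set R) k a :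
  right_annihilator X a -> right_annihilator X (xinv_term delta alpha_bij k a).
Proof.
have V b : right_annihilator X b -> right_annihilator X (alphaV b).
  (* Since [s * alpha (alphaV b) = s * b = 0], alpha-compatibility read from right to left gives
     [s * alphaV b = 0]. *)
  by move=> Xb s /Xb sb; apply/compat.1; rewrite bij_invVK.
move=> Xa; apply: (V); elim: k => //= k /V IH s /IH sb.
by rewrite mulrN compat.2 ?oppr0.
Qed.

Lemma right_annihilator_xinv_coef (X : set R) m (f : int -> R) n :
    vanish_below m f -> (forall i, right_annihilator X (f i)) ->
  right_annihilator X (xinv_coef delta alpha_bij f n).
Proof.
move=> fm Xf s Xs; rewrite (xinv_coefE delta alpha_bij (N := absz (n - m)) fm); last by lia.
rewrite mulr_sumr big1// => k _.
exact: (right_annihilator_xinv_term k (Xf _)) Xs.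
Qed.

Lemma right_annihilator_xpow_coef (X : set R) m (f : int -> R) (k : nat) n :
    vanish_below m f -> (forall i, right_annihilator X (f i)) ->
  right_annihilator X (xpow_coef delta alpha_bij k f n).
Proof.
move=> fm Xf; elim: k n => [|k IH] n //=.
exact: right_annihilator_xinv_coef (vanish_xpow delta alpha_bij (i := k) fm) IH.
Qed.

Lemma vanish_power_series (f : S) : vanish_below 0 (lcoef f).
Proof. exact/is_power_seriesP/laurent_ofP. Qed.

Lemma skew_power_seriesP (f g : S) : (forall n : nat, f n = g n) -> f = g.
Proof.
move=> fg; apply: val_inj; apply/skew_laurentP => -[n|n]; first exact: fg.
by rewrite !vanish_power_series.
Qed.

Lemma power_series_coefM (f g : S) (n : nat) :
  (f * g) n = \sum_(k < n.+1) f k * xpow_coef delta alpha_bij k g n.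
Proof.
rewrite -[LHS]/(laurent_mul_coef delta alpha_bij f g n).
(* The series [x^-k g] vanishes below degree [k] in [x^-1], so only the terms with [k <= n]
   remain. *)
rewrite (laurent_mul_coefE delta alpha_bij (N := n.+1) (m := 0) (p := 0)) //.
- exact: vanish_power_series.
- exact: vanish_power_series.
- by lia.
Qed.

Lemma constant_termM (f g : S) : (f * g) 0 = f 0 * g 0.
Proof. by rewrite (power_series_coefM f g 0) big_ord1. Qed.

Fact power_series_const_subproof (a : R) :
  laurent_monomial alpha_bij deltaM a 0 \in
    @is_power_series _ _ _ alpha_bij deltaM.
Proof. by apply/is_power_seriesP => i i0; rewrite lcoef_monomial lt_eqF. Qed.

Definition power_series_const (a : R) : S :=
  SkewPowerSeries (power_series_const_subproof a).

(** With the constant on the left, no power of [x^-1] has to cross a coefficient. *)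
Lemma power_series_constM a (f : S) (n : nat) :
  (power_series_const a * f) n = a * f n.
Proof.
rewrite power_series_coefM big_ord_recl big1 ?addr0 // => k _.
by rewrite lcoef_monomial mul0r.
Qed.

Lemma power_series_const_idem a :
  a * a = a -> power_series_const a * power_series_const a = power_series_const a.
Proof.
move=> aa; apply: skew_power_seriesP => n; rewrite power_series_constM.
by rewrite lcoef_monomial; case: eqP => _; rewrite ?aa ?mulr0.
Qed.

(** Constant multipliers already test every coefficient. Conversely, the coefficients of [a s f] are
    sums of terms [a s_k (x^-k f)_n], and compatibility keeps the coefficients of [x^-k f] in
    r_R(aR). *)
Lemma right_annihilator_constP a (f : S) :
  right_annihilator (right_principal (power_series_const a)) f <->
  forall n : nat, right_annihilator (right_principal a) (f n).
Proof.
rewrite right_annihilator_principalP; split=> [af n|af s].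
  apply/right_annihilator_principalP => r.
  have := congr1 (fun g : S => g n) (af (power_series_const r)).
  by rewrite -mulrA !power_series_constM mulrA.
apply: skew_power_seriesP => n; rewrite -mulrA power_series_constM.
rewrite power_series_coefM mulr_sumr big1 // => k _; rewrite mulrA.
apply: (right_annihilator_xpow_coef (X := right_principal a) (m := 0)).
- exact: vanish_power_series.
- case=> i; first exact: af.
  by rewrite vanish_power_series// => s' _; rewrite mulr0.
- by exists (s k).
Qed.

(** If [f] vanishes below degree [n], then [x^-k f] with [k > 0] vanishes up to degree [n], so the
    coefficient of [u f] in degree [n] is [f n]. *)
Lemma constant_term1_regular (u f : S) : u 0 = 1 -> u * f = 0 -> f = 0.
Proof.
move=> u0 uf; apply: skew_power_seriesP => n.
elim/ltn_ind: n => n IH.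
have fn : vanish_below n (lcoef f).
  case=> i; last by move=> _; rewrite vanish_power_series.
  exact: IH.
have := congr1 (fun g : S => g n) uf; rewrite power_series_coefM.
rewrite big_ord_recl u0 mul1r big1 ?addr0 // => k _.
by rewrite (vanish_xpow delta alpha_bij fn) ?mulr0 // lift0; lia.
Qed.

Lemma right_annihilator_eq_constant_term (E F f : S) :
    E * E = E -> E 0 = F 0 ->
  right_annihilator (right_principal F) f ->
  right_annihilator (right_principal E) f.
Proof.
move=> EE EF0 /right_annihilator_principalP Ff.
apply/right_annihilator_principalP => s.
apply: (@constant_term1_regular (F * E + (1 - F) * (1 - E))).
  have EE0 : E 0 * E 0 = E 0 by rewrite -constant_termM EE.
  have compl0 (G : S) : (1 - G) 0 = 1 - G 0 by [].
  (* With [e = E 0] the constant term is [e e + (1 - e)(1 - e) = 1]. *)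
  rewrite lcoefD !constant_termM !compl0 -EF0 EE0.
  by rewrite mulrBl mul1r mulrBr mulr1 EE0 subrr subr0 addrC subrK.
have complE : (1 - E) * E = 0 by rewrite mulrBl mul1r EE subrr.
(* The second summand dies by [(1 - E) E = 0]; the first becomes [F (E s) f], an instance of
   [Ff]. *)
rewrite !mulrA 2!mulrDl -[F * E * E]mulrA EE -[(1 - F) * _ * E]mulrA complE.
by rewrite mulr0 !mul0r addr0 -(mulrA F) Ff.
Qed.

Lemma right_cP_Baer_power_series : right_cP_Baer R -> right_cP_Baer S.
Proof.
move=> RB E EE.
have ee : E 0 * E 0 = E 0 by rewrite -constant_termM EE.
have [c cc ec] := RB _ ee; have KC := power_series_const_idem cc.
have KE := power_series_const_idem ee.
exists (power_series_const c) => //; apply/predeqP => f.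
rewrite (right_principalP _ KC).
apply: (@iff_trans _ (right_annihilator
  (right_principal (power_series_const (E 0))) f)).
  (* Both [E] and the constant series [E 0] are idempotent, so one lemma gives both inclusions. *)
  by split; apply: right_annihilator_eq_constant_term; rewrite // lcoef_monomial.
rewrite right_annihilator_constP ec; split=> [cf|cf n].
  apply: skew_power_seriesP => n; rewrite power_series_constM.
  exact/right_principalP.
by apply/(right_principalP _ cc); rewrite -power_series_constM cf.
Qed.

Lemma right_cP_Baer_of_power_series : right_cP_Baer S -> right_cP_Baer R.
Proof.
move=> SB e ee; have [C CC eC] := SB _ (power_series_const_idem ee).
have cc : C 0 * C 0 = C 0 by rewrite -constant_termM CC.
exists (C 0) => //; apply/predeqP => a; rewrite (right_principalP _ cc).
split=> [ea|ca].
  (* Embed [a] as a constant series, then take constant terms in [C a = a]. *)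
  have: right_principal C (power_series_const a).
    rewrite -eC; apply/right_annihilator_constP => n.
    by rewrite lcoef_monomial; case: eqP => // _ s _; rewrite mulr0.
  move=> /(right_principalP _ CC)/(congr1 (fun g : S => g 0)).
  by rewrite constant_termM lcoef_monomial.
(* As [C] lies in [CS], it annihilates [eS]; hence [C 0], and with it [a = C 0 * a], annihilates
   [eR]. *)
have: right_principal C C by apply/right_principalP.
rewrite -eC => /right_annihilator_constP/(_ 0) eC0 s /eC0 sC.
by rewrite -ca mulrA sC mul0r.
Qed.

End CompatiblePowerSeries.

Theorem theorem2p40 (R : pzRingType) (alpha : {rmorphism R -> R})
    (delta : {additive R -> R}) (alpha_bij : bijective alpha)
    (deltaM : alpha_derivation alpha delta) :
  alpha_delta_compatible alpha delta ->
  right_cP_Baer R <-> right_cP_Baer (skew_power_series alpha_bij deltaM).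
Proof.
move=> compat; split; first exact: right_cP_Baer_power_series.
exact: right_cP_Baer_of_power_series.
Qed.
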